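(* Let $F_4$ be the free nilpotent group of class $2$ and rank $4$ with basis $x_1,x_2,x_3,x_4$. Let $a_{ij}\in\mathbb{Z}\setminus\{0\}$ for $1\le i<j\le 4$, let $C<F_4$ be the cyclic subgroup \[ C=\Big\langle \prod_{1\le i<j\le 4}[x_i,x_j]^{a_{ij}}\Big\rangle , \] and let \[ \epsilon := \frac{\left|\prod_{1\le i<j\le 4} a_{ij}\right|}{\prod_{1\le i<j\le 4} a_{ij}} . \] If $F_4/C$ has an abelian subgroup that contains the center of $F_4/C$ and has rank greater than one over the center, then \[ \epsilon\left(\frac{1}{a_{14}a_{23}}+\frac{1}{a_{12}a_{34}}\right) > \epsilon\left(\frac{1}{a_{13}a_{24}}\right). \]
   Context: Commutators are $[x,y]=x^{-1}y^{-1}xy$. The free nilpotent group of class $2$ and rank $n$ with basis $x_1,\dots,x_n$ is the quotient of the free group on $x_1,\dots,x_n$ by the third term of its lower central series (i.e. by all $[[x,y],z]$). The subgroup $C$ is central, hence normal. For an abelian subgroup $A$ of a group $G$ containing the center $\zeta G$, the rank of $A$ over the center is the torsion-free rank of $A/\zeta G$, i.e. $\dim_{\mathbb{Q}}\big((A/\zeta G)\otimes_{\mathbb{Z}}\mathbb{Q}\big)$. *)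

(* Defs.v *)
From HB Require Import structures.
From mathcomp Require Import all_boot all_order all_algebra.
From mathcomp Require Import boolp classical_sets functions cardinality.

Set Implicit Arguments.
Unset Strict Implicit.
Unset Printing Implicit Defensive.

Import GRing.Theory.

Local Open Scope quotient_scope.
Local Open Scope group_scope.

HB.mixin Record isConjClosed (G : groupType) (S : {pred G}) := {
  gpredJr : forall x y : G, x \in S -> x ^ y \in S
}.

#[short(type="normalClosed")]
HB.structure Definition NormalClosed (G : groupType) :=
  {S of isConjClosed G S & GroupClosed G S}.

Section QuotientGroup.
Variables (G : groupType) (N : normalClosed G).

Definition coset_rel : rel G := fun x y => x^-1 * y \in N.

Lemma coset_rel_equiv : equiv_class_of coset_rel.
Proof.
split=> [x|x y|y x z].
- by rewrite /coset_rel mulVg gpred1.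
- by rewrite /coset_rel -gpredV invgM invgK.
- rewrite /coset_rel => xy yz.
  by rewrite -(mulgK y x^-1) -mulgA gpredM.
Qed.

Canonical coset_equiv_rel := EquivRelPack coset_rel_equiv.

Definition quot_group := {eq_quot coset_rel}.

HB.instance Definition _ := Choice.on quot_group.
HB.instance Definition _ := EqQuotient.on quot_group.

Definition qpi (x : G) : quot_group := \pi x.

Lemma qpiP x y : qpi x = qpi y <-> x^-1 * y \in N.
Proof. 
split=> h; first exact: (introT (eqmodP coset_equiv_rel x y) h).
exact: (elimT (eqmodP coset_equiv_rel x y) h). Qed.

Lemma repr_qpi x : (repr (qpi x))^-1 * x \in N.
Proof. by apply/qpiP; rewrite /qpi reprK. Qed.

Definition quot_one : quot_group := qpi 1.
Definition quot_mul (x y : quot_group) : quot_group := qpi (repr x * repr y).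
Definition quot_inv (x : quot_group) : quot_group := qpi (repr x)^-1.

Lemma qpi_mul x y : quot_mul (qpi x) (qpi y) = qpi (x * y).
Proof.
apply/qpiP; set r := repr _; set s := repr _.
have -> : (r * s)^-1 * (x * y) = (r^-1 * x) ^ s * (s^-1 * y).
  by rewrite /conjg invgM !mulgA mulgK.
by rewrite gpredM ?gpredJr ?repr_qpi.
Qed.

Lemma qpi_inv x : quot_inv (qpi x) = qpi x^-1.
Proof.
apply/qpiP; set r := repr _; rewrite invgK.
have -> : r * x^-1 = ((r^-1 * x)^-1) ^ r^-1.
  by rewrite /conjg invgM !invgK mulgK.
by rewrite gpredJr // gpredV repr_qpi.
Qed.

Lemma qpi_surj (x : quot_group) : exists y, x = qpi y.
Proof. by exists (repr x); rewrite /qpi reprK. Qed.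

Lemma quot_mulA : associative quot_mul.
Proof.
move=> x y z; have [x' ->] := qpi_surj x; have [y' ->] := qpi_surj y.
by have [z' ->] := qpi_surj z; rewrite !qpi_mul mulgA.
Qed.

Lemma quot_mul1g : left_id quot_one quot_mul.
Proof. by move=> x; have [x' ->] := qpi_surj x; rewrite qpi_mul mul1g. Qed.

Lemma quot_mulg1 : right_id quot_one quot_mul.
Proof. by move=> x; have [x' ->] := qpi_surj x; rewrite qpi_mul mulg1. Qed.

Lemma quot_mulVg : left_inverse quot_one quot_inv quot_mul.
Proof.
by move=> x; have [x' ->] := qpi_surj x; rewrite qpi_inv qpi_mul mulVg.
Qed.

Lemma quot_mulgV : right_inverse quot_one quot_inv quot_mul.
Proof.
by move=> x; have [x' ->] := qpi_surj x; rewrite qpi_inv qpi_mul mulgV.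
Qed.

HB.instance Definition _ := isGroup.Build quot_group
  quot_mulA quot_mul1g quot_mulg1 quot_mulVg quot_mulgV.

Lemma qpi_div : {morph qpi : x y / x / y >-> x / y}.
Proof. by move=> x y; rewrite -qpi_mul -qpi_inv. Qed.

HB.instance Definition _ := isGroupMorphism.Build G quot_group qpi qpi_div.

End QuotientGroup.

Section Subgroups.
Variable G : groupType.

Definition generated (S : {pred G}) : {pred G} :=
  fun x => `[< forall H : groupClosed G, {subset S <= H} -> x \in H >].

Section Generated.
Variable S : {pred G}.

Lemma generatedP x :
  reflect (forall H : groupClosed G, {subset S <= H} -> x \in H)
          (x \in generated S).
Proof. exact: asboolP. Qed.

Lemma generated_sub : {subset S <= generated S}.
Proof. by move=> x xS; apply/generatedP => H; apply. Qed.

Lemma generated1 : 1 \in generated S.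
Proof. by apply/generatedP => H _; apply: gpred1. Qed.

Lemma generatedM : mulg_closed (generated S).
Proof.
move=> x y /generatedP xS /generatedP yS; apply/generatedP => H SH.
by rewrite gpredM ?xS ?yS.
Qed.

Lemma generatedV : invg_closed (generated S).
Proof.
move=> x /generatedP xS; apply/generatedP => H SH.
by rewrite gpredV xS.
Qed.

HB.instance Definition _ := isMulClosed.Build G (generated S) generatedM.
HB.instance Definition _ := isMul1Closed.Build G (generated S) generated1.
HB.instance Definition _ := isInvClosed.Build G (generated S) generatedV.

End Generated.

(* MathComp's [~ x, y] is x^-1 * (y^-1 * (x * y)). *)
Definition commutator_subgroup (A B : {pred G}) : {pred G} :=
  generated (fun z => `[< exists x y, [/\ x \in A, y \in B & z = [~ x, y]] >]).

(* Indexed from 1, as usual: the first term is the whole group (so is the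
   meaningless zeroth term), and the third one is [~: [~: G, G], G]. *)
Definition lower_central (k : nat) : {pred G} :=
  iter k.-1 (fun H => commutator_subgroup H predT) predT.

Lemma lower_central_comm k x y :
  x \in lower_central k.+1 -> [~ x, y] \in lower_central k.+2.
Proof. by move=> xk; apply/generated_sub/asboolP; exists x, y. Qed.

Section LowerCentral.
Variable k : nat.

Lemma lower_central1 : 1 \in lower_central k.
Proof. by case: k => [|[|j]] //; apply: generated1. Qed.

Lemma lower_centralM : mulg_closed (lower_central k).
Proof. by case: k => [|[|j]] //; apply: generatedM. Qed.

Lemma lower_centralV : invg_closed (lower_central k).
Proof. by case: k => [|[|j]] //; apply: generatedV. Qed.

End LowerCentral.

HB.instance Definition _ k :=
  isMulClosed.Build G (lower_central k) (@lower_centralM k).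
HB.instance Definition _ k :=
  isMul1Closed.Build G (lower_central k) (lower_central1 k).
HB.instance Definition _ k :=
  isInvClosed.Build G (lower_central k) (@lower_centralV k).

Lemma lower_central_sub1 k x :
  x \in lower_central k.+2 -> x \in lower_central k.+1.
Proof.
elim: k x => [|k IH] x; first by [].
move/generatedP => /(_ (lower_central k.+2)); apply=> z /asboolP[u [v [/IH uk _ ->]]].
exact: lower_central_comm.
Qed.

Lemma lower_centralJ k x y :
  x \in lower_central k -> x ^ y \in lower_central k.
Proof.
case: k => [|k] // xk; have -> : x ^ y = x * [~ x, y] by rewrite commgEl mulVKg.
by apply: lower_centralM => //; apply/lower_central_sub1/lower_central_comm.
Qed.

HB.instance Definition _ k :=
  isConjClosed.Build G (lower_central k) (@lower_centralJ k).

Definition center : {pred G} := fun x => `[< forall y, commute x y >].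

Lemma centerP x : reflect (forall y, commute x y) (x \in center).
Proof. exact: asboolP. Qed.

Lemma center1 : 1 \in center.
Proof. by apply/centerP => y; apply/commute_sym/commute1. Qed.

Lemma centerM : mulg_closed center.
Proof.
move=> x y /centerP xC /centerP yC; apply/centerP => z.
by apply/commute_sym/commuteM; apply/commute_sym.
Qed.

Lemma centerV : invg_closed center.
Proof.
by move=> x /centerP xC; apply/centerP => z; apply/commute_sym/commuteV/commute_sym.
Qed.

Lemma centerJ x y : x \in center -> x ^ y \in center.
Proof. by move=> xC; rewrite /conjg (centerP _ xC y) mulKg. Qed.

HB.instance Definition _ := isMulClosed.Build G center centerM.
HB.instance Definition _ := isMul1Closed.Build G center center1.
HB.instance Definition _ := isInvClosed.Build G center centerV.
HB.instance Definition _ := isConjClosed.Build G center centerJ.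

Lemma generated_central (S : {pred G}) :
  {subset S <= center} -> forall x y, x \in generated S -> x ^ y \in generated S.
Proof.
move=> SC x y xS; have /generatedP/(_ center SC)/centerP xC := xS.
by rewrite /conjg xC mulKg.
Qed.

Definition expgz (x : G) (k : int) : G :=
  match k with Posz n => x ^+ n | Negz n => x ^- n.+1 end.

Lemma gpredXz (H : groupClosed G) x k : x \in H -> expgz x k \in H.
Proof. by case: k => n xH; rewrite /expgz ?gpredV gpredXn. Qed.

End Subgroups.

Arguments lower_central : clear implicits.
Arguments center : clear implicits.

Section SubgroupType.
Variables (G : groupType) (A : groupClosed G).

Definition subgroup_type := {x : G | x \in A}.

HB.instance Definition _ := SubChoice.on subgroup_type.

Lemma subgroup_type_closed : group_closed A.
Proof. by split; [apply: gpred1 | apply: gpredF]. Qed.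

HB.instance Definition _ :=
  SubChoice_isSubGroup.Build G _ subgroup_type subgroup_type_closed.

End SubgroupType.

Section SubgroupQuotient.
Variables (G : groupType) (A : groupClosed G) (N : normalClosed G).

Definition trace_normal : {pred subgroup_type A} := fun x => val x \in N.

Lemma trace_normalE x : (x \in trace_normal) = (val x \in N).
Proof. by []. Qed.

Lemma trace_normal1 : 1 \in trace_normal.
Proof. by rewrite trace_normalE gmulf1 gpred1. Qed.

Lemma trace_normalM : mulg_closed trace_normal.
Proof. by move=> x y; rewrite !trace_normalE gmulfM; apply: gpredM. Qed.

Lemma trace_normalV : invg_closed trace_normal.
Proof. by move=> x; rewrite !trace_normalE gmulfV gpredV. Qed.

Lemma trace_normalJ x y : x \in trace_normal -> x ^ y \in trace_normal.
Proof. by rewrite !trace_normalE gmulfJ; apply: gpredJr. Qed.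

HB.instance Definition _ :=
  isMulClosed.Build (subgroup_type A) trace_normal trace_normalM.
HB.instance Definition _ :=
  isMul1Closed.Build (subgroup_type A) trace_normal trace_normal1.
HB.instance Definition _ :=
  isInvClosed.Build (subgroup_type A) trace_normal trace_normalV.
HB.instance Definition _ :=
  isConjClosed.Build (subgroup_type A) trace_normal trace_normalJ.

(* A / (A :&: N), that is, A / N when N is contained in A. *)
Definition subquotient := quot_group trace_normal.
HB.instance Definition _ := Group.on subquotient.

End SubgroupQuotient.

Section FreeGroup.
Variable X : choiceType.

(* The letter (x, true) stands for x, and (x, false) for x^-1. *)
Definition word := seq (X * bool).

Inductive free_eq : word -> word -> Prop :=
| free_refl u : free_eq u u
| free_sym u v : free_eq u v -> free_eq v u
| free_trans u v w : free_eq u v -> free_eq v w -> free_eq u w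
| free_cancel u v x b : free_eq (u ++ [:: (x, b); (x, ~~ b)] ++ v) (u ++ v).

Definition free_rel : rel word := fun u v => `[< free_eq u v >].

Lemma free_rel_equiv : equiv_class_of free_rel.
Proof.
split=> [u|u v|v u w]; first by apply/asboolP/free_refl.
  by apply/asboolP/asboolP; apply: free_sym.
by move=> /asboolP uv /asboolP vw; apply/asboolP/(free_trans uv).
Qed.

Canonical free_equiv_rel := EquivRelPack free_rel_equiv.

Definition free_group := {eq_quot free_rel}.

HB.instance Definition _ := Choice.on free_group.
HB.instance Definition _ := EqQuotient.on free_group.

Definition fpi (u : word) : free_group := \pi u.

Lemma fpiP u v : fpi u = fpi v <-> free_eq u v.
Proof.
split=> [h|uv].
  by apply/asboolP; exact: (introT (eqmodP free_equiv_rel u v) h).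
by apply: (elimT (eqmodP free_equiv_rel u v)); apply/asboolP.
Qed.

Lemma repr_fpi u : free_eq (repr (fpi u)) u.
Proof. by apply/fpiP; rewrite /fpi reprK. Qed.

Definition word_inv (u : word) : word := rev [seq (l.1, ~~ l.2) | l <- u].

Lemma free_catl w u v : free_eq u v -> free_eq (w ++ u) (w ++ v).
Proof.
elim=> {u v} [u|u v _|u v t _ uv _ vt|u v x b]; first exact: free_refl.
- exact: free_sym.
- exact: free_trans uv vt.
- by rewrite !(catA w u); apply: free_cancel.
Qed.

Lemma free_catr w u v : free_eq u v -> free_eq (u ++ w) (v ++ w).
Proof.
elim=> {u v} [u|u v _|u v t _ uv _ vt|u v x b]; first exact: free_refl.
- exact: free_sym.
- exact: free_trans uv vt.
- by rewrite -!catA; apply: free_cancel.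
Qed.

Lemma word_inv_cat u v : word_inv (u ++ v) = word_inv v ++ word_inv u.
Proof. by rewrite /word_inv map_cat rev_cat. Qed.

Lemma word_invK : involutive word_inv.
Proof.
move=> u; rewrite /word_inv map_rev revK -map_comp -[RHS]map_id.
by apply: eq_map => -[x b] /=; rewrite negbK.
Qed.

Lemma free_inv u v : free_eq u v -> free_eq (word_inv u) (word_inv v).
Proof.
elim=> {u v} [u|u v _|u v t _ uv _ vt|u v x b]; first exact: free_refl.
- exact: free_sym.
- exact: free_trans uv vt.
- rewrite !word_inv_cat -catA /word_inv /= /rev /= negbK.
  exact: free_cancel.
Qed.

Lemma free_mulV u : free_eq (u ++ word_inv u) [::].
Proof.
elim/last_ind: u => [|u [x b] IH]; first exact: free_refl.
rewrite -cats1 word_inv_cat -catA.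
exact: (free_trans (free_cancel _ _ x b)).
Qed.

Definition free_one : free_group := fpi [::].
Definition free_mul (x y : free_group) : free_group := fpi (repr x ++ repr y).
Definition free_invg (x : free_group) : free_group := fpi (word_inv (repr x)).

Lemma fpi_mul u v : free_mul (fpi u) (fpi v) = fpi (u ++ v).
Proof.
apply/fpiP; apply: (free_trans (free_catl _ (repr_fpi v))).
exact/free_catr/repr_fpi.
Qed.

Lemma fpi_inv u : free_invg (fpi u) = fpi (word_inv u).
Proof. exact/fpiP/free_inv/repr_fpi. Qed.

Lemma fpi_surj (x : free_group) : exists u, x = fpi u.
Proof. by exists (repr x); rewrite /fpi reprK. Qed.

Lemma free_mulgA : associative free_mul.
Proof.
move=> x y z; have [x' ->] := fpi_surj x; have [y' ->] := fpi_surj y.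
by have [z' ->] := fpi_surj z; rewrite !fpi_mul catA.
Qed.

Lemma free_mul1g : left_id free_one free_mul.
Proof. by move=> x; have [x' ->] := fpi_surj x; rewrite fpi_mul. Qed.

Lemma free_mulg1 : right_id free_one free_mul.
Proof. by move=> x; have [x' ->] := fpi_surj x; rewrite fpi_mul cats0. Qed.

Lemma free_mulgV : right_inverse free_one free_invg free_mul.
Proof.
move=> x; have [u ->] := fpi_surj x; rewrite fpi_inv fpi_mul.
exact/fpiP/free_mulV.
Qed.

Lemma free_mulVg : left_inverse free_one free_invg free_mul.
Proof.
move=> x; have [u ->] := fpi_surj x; rewrite fpi_inv fpi_mul.
by apply/fpiP; rewrite -[X in _ ++ X]word_invK; apply: free_mulV.
Qed.

HB.instance Definition _ := isGroup.Build free_group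
  free_mulgA free_mul1g free_mulg1 free_mulVg free_mulgV.

Definition free_gen (x : X) : free_group := fpi [:: (x, true)].

End FreeGroup.

Definition free_nilpotent (c n : nat) :=
  quot_group (lower_central (free_group 'I_n) c.+1).

HB.instance Definition _ c n := Group.on (free_nilpotent c n).

(* The basis x_1, ..., x_n is indexed from 0 here. *)
Definition free_nilpotent_gen (c n : nat) (i : 'I_n) : free_nilpotent c n :=
  qpi _ (free_gen i).

Section CyclicQuotient.
Variables (n : nat) (a : 'I_n -> 'I_n -> int).

Local Notation x_ := (@free_nilpotent_gen 2 n).

(* The factors are central, so that their order is irrelevant. *)
Definition relator : free_nilpotent 2 n :=
  \prod_(i < n) \prod_(j < n | (i < j)%N) expgz [~ x_ i, x_ j] (a i j).

Definition cyclic_relator : {pred free_nilpotent 2 n} :=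
  generated (pred1 relator).

Lemma free_nilpotent2_central (x y : free_nilpotent 2 n) :
  [~ x, y] \in center (free_nilpotent 2 n).
Proof.
apply/centerP => z; apply/commgP/eqP.
have [x' ->] := qpi_surj x; have [y' ->] := qpi_surj y.
have [z' ->] := qpi_surj z.
transitivity (qpi (lower_central (free_group 'I_n) 3) [~ [~ x', y'], z']).
  by rewrite !gmulfR.
transitivity (qpi (lower_central (free_group 'I_n) 3) 1); last exact: gmulf1.
apply/qpiP; rewrite mulg1 gpredV.
have c2 : [~ x', y'] \in lower_central (free_group 'I_n) 2.
  exact: lower_central_comm.
exact: lower_central_comm c2.
Qed.

Lemma relator_central : relator \in center (free_nilpotent 2 n).
Proof.
apply: gpred_prod => i _; apply: gpred_prod => j _.
exact/gpredXz/free_nilpotent2_central.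
Qed.

Lemma cyclic_relatorJ x y :
  x \in cyclic_relator -> x ^ y \in cyclic_relator.
Proof.
by apply: generated_central => z /eqP ->; apply: relator_central.
Qed.

HB.instance Definition _ := GroupClosed.on cyclic_relator.
HB.instance Definition _ :=
  isConjClosed.Build (free_nilpotent 2 n) cyclic_relator cyclic_relatorJ.

Definition free_nilpotent2_mod := quot_group cyclic_relator.
HB.instance Definition _ := Group.on free_nilpotent2_mod.

End CyclicQuotient.

Local Open Scope ring_scope.

(* For an abelian group H, written multiplicatively, this is the tensor product
   of H and rat over the integers: formal sums of pairs (x, q), standing for
   pure tensors, modulo the congruence generated by commutativity and
   bilinearity. *)
Section TensorRat.
Variable H : groupType.

Definition tensor_sum := seq (H * rat).

Inductive tensor_eq : tensor_sum -> tensor_sum -> Prop :=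
| tensor_refl s : tensor_eq s s
| tensor_sym s t : tensor_eq s t -> tensor_eq t s
| tensor_trans s t u : tensor_eq s t -> tensor_eq t u -> tensor_eq s u
| tensor_cat s s' t t' :
    tensor_eq s s' -> tensor_eq t t' -> tensor_eq (s ++ t) (s' ++ t')
| tensor_comm s t : tensor_eq (s ++ t) (t ++ s)
| tensor_addl x y p : tensor_eq [:: ((x * y)%g, p)] [:: (x, p); (y, p)]
| tensor_addr x p q : tensor_eq [:: (x, p + q)] [:: (x, p); (x, q)]
| tensor_zero x : tensor_eq [:: (x, 0)] [::].

Definition tensor_rel : rel tensor_sum := fun s t => `[< tensor_eq s t >].

Lemma tensor_rel_equiv : equiv_class_of tensor_rel.
Proof.
split=> [s|s t|t s u]; first by apply/asboolP/tensor_refl.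
  by apply/asboolP/asboolP; apply: tensor_sym.
by move=> /asboolP st /asboolP tu; apply/asboolP/(tensor_trans st).
Qed.

Canonical tensor_equiv_rel := EquivRelPack tensor_rel_equiv.

Definition tensor_rat := {eq_quot tensor_rel}.

HB.instance Definition _ := Choice.on tensor_rat.
HB.instance Definition _ := EqQuotient.on tensor_rat.

Definition tpi (s : tensor_sum) : tensor_rat := \pi s.

Lemma tpiP s t : tpi s = tpi t <-> tensor_eq s t.
Proof.
split=> [h|st].
  by apply/asboolP; exact: (introT (eqmodP tensor_equiv_rel s t) h).
by apply: (elimT (eqmodP tensor_equiv_rel s t)); apply/asboolP.
Qed.

Lemma repr_tpi s : tensor_eq (repr (tpi s)) s.
Proof. by apply/tpiP; rewrite /tpi reprK. Qed.

Lemma tpi_surj (v : tensor_rat) : exists s, v = tpi s.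
Proof. by exists (repr v); rewrite /tpi reprK. Qed.

Definition sum_scale (c : rat) (s : tensor_sum) : tensor_sum :=
  [seq (l.1, c * l.2) | l <- s].

Lemma tensor_eq_scale c s t :
  tensor_eq s t -> tensor_eq (sum_scale c s) (sum_scale c t).
Proof.
elim=> {s t} /= [s|s t _|s t u _ st _ tu|s s' t t' _ ss' _ tt'|s t|x y p|x p q|x].
- exact: tensor_refl.
- exact: tensor_sym.
- exact: tensor_trans st tu.
- by rewrite /sum_scale !map_cat; apply: tensor_cat.
- by rewrite /sum_scale !map_cat; apply: tensor_comm.
- exact: tensor_addl.
- by rewrite mulrDr; apply: tensor_addr.
- by rewrite mulr0; apply: tensor_zero.
Qed.

Lemma sum_scaleDl c d s :
  tensor_eq (sum_scale (c + d) s) (sum_scale c s ++ sum_scale d s).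
Proof.
elim: s => [|[x p] s IH] /=; first exact: tensor_refl.
rewrite mulrDl; apply: (tensor_trans (tensor_cat (tensor_addr x _ _) IH)).
set u := sum_scale c s; set v := sum_scale d s.
rewrite [X in tensor_eq _ X](_ : _ =
    [:: (x, c * p)] ++ (u ++ [:: (x, d * p)]) ++ v); last by rewrite /= -catA.
apply: (@tensor_cat [:: (x, c * p)] _ ([:: (x, d * p)] ++ u ++ v)).
  exact: tensor_refl.
rewrite catA; apply: tensor_cat; [exact: tensor_comm | exact: tensor_refl].
Qed.

Lemma sum_scale0 s : tensor_eq (sum_scale 0 s) [::].
Proof.
elim: s => [|[x p] s IH] /=; first exact: tensor_refl.
by rewrite mul0r; apply: (tensor_cat (tensor_zero x) IH).
Qed.

Lemma sum_scale1 s : sum_scale 1 s = s.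
Proof.
by rewrite /sum_scale -[RHS]map_id; apply: eq_map => -[x p] /=; rewrite mul1r.
Qed.

Definition tensor0 : tensor_rat := tpi [::].
Definition tensor_add (v w : tensor_rat) : tensor_rat := tpi (repr v ++ repr w).
Definition tensor_scale (c : rat) (v : tensor_rat) : tensor_rat :=
  tpi (sum_scale c (repr v)).
Definition tensor_opp : tensor_rat -> tensor_rat := tensor_scale (-1).

Lemma tpi_add s t : tensor_add (tpi s) (tpi t) = tpi (s ++ t).
Proof. by apply/tpiP/tensor_cat; apply: repr_tpi. Qed.

Lemma tpi_scale c s : tensor_scale c (tpi s) = tpi (sum_scale c s).
Proof. exact/tpiP/tensor_eq_scale/repr_tpi. Qed.

Lemma tensor_addA : associative tensor_add.
Proof.
move=> u v w; have [r ->] := tpi_surj u; have [s ->] := tpi_surj v.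
by have [t ->] := tpi_surj w; rewrite !tpi_add catA.
Qed.

Lemma tensor_addC : commutative tensor_add.
Proof.
move=> u v; have [r ->] := tpi_surj u; have [s ->] := tpi_surj v.
by rewrite !tpi_add; apply/tpiP/tensor_comm.
Qed.

Lemma tensor_add0 : left_id tensor0 tensor_add.
Proof. by move=> v; have [s ->] := tpi_surj v; rewrite tpi_add. Qed.

Lemma tensor_addN : left_inverse tensor0 tensor_opp tensor_add.
Proof.
move=> v; have [s ->] := tpi_surj v.
rewrite /tensor_opp tpi_scale tpi_add -[X in _ ++ X]sum_scale1.
apply/tpiP/(tensor_trans (tensor_sym (sum_scaleDl _ _ _))).
by rewrite addNr; apply: sum_scale0.
Qed.

HB.instance Definition _ := GRing.isZmodule.Build tensor_rat
  tensor_addA tensor_addC tensor_add0 tensor_addN.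

Lemma tensor_scaleA c d v :
  tensor_scale c (tensor_scale d v) = tensor_scale (c * d) v.
Proof.
have [s ->] := tpi_surj v; rewrite !tpi_scale /sum_scale -map_comp.
by congr tpi; apply: eq_map => -[x p] /=; rewrite mulrA.
Qed.

Lemma tensor_scale1 : left_id 1 tensor_scale.
Proof. by move=> v; have [s ->] := tpi_surj v; rewrite tpi_scale sum_scale1. Qed.

Lemma tensor_scaleDr : right_distributive tensor_scale +%R.
Proof.
move=> c v w; have [s ->] := tpi_surj v; have [t ->] := tpi_surj w.
by rewrite /+%R /= tpi_add !tpi_scale tpi_add /sum_scale map_cat.
Qed.

Lemma tensor_scaleDl v : {morph tensor_scale^~ v : c d / c + d}.
Proof.
move=> c d; have [s ->] := tpi_surj v.
by rewrite [RHS]/+%R /= !tpi_scale tpi_add; apply/tpiP/sum_scaleDl.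
Qed.

HB.instance Definition _ := GRing.Zmodule_isLmodule.Build rat tensor_rat
  tensor_scaleA tensor_scale1 tensor_scaleDr tensor_scaleDl.

Definition pure_tensor (x : H) (q : rat) : tensor_rat := tpi [:: (x, q)].

End TensorRat.

Section Dimension.
Variables (K : fieldType) (V : lmodType K).

Definition lin_indep (B : set V) : Prop :=
  forall (s : seq V) (c : V -> K), uniq s -> (forall v, v \in s -> B v) ->
    \sum_(v <- s) c v *: v = 0 -> forall v, v \in s -> c v = 0.

Definition spanning (B : set V) : Prop :=
  forall w : V, exists (s : seq V) (c : V -> K),
    (forall v, v \in s -> B v) /\ w = \sum_(v <- s) c v *: v.

(* \dim is restricted to finite-dimensional spaces, whence a
   comparison of the cardinal of a basis with d. *)
Definition dim_gt (d : nat) : Prop :=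
  exists B : set V, [/\ lin_indep B, spanning B & ~ (B #<= `I_d)%card].

End Dimension.

Definition rank_over_center_gt (G : groupType) (A : groupClosed G) (d : nat)
  : Prop :=
  dim_gt (tensor_rat (subquotient A (center G))) d.

(* Main.v *)
(* Modulo its derived subgroup the free nilpotent group F of class 2 is Z^n, and
   commutators of F are read off from the exponent vectors u, v of their
   arguments as the skew matrix u^T v - v^T u; this is detected by mapping F to
   a Heisenberg-type group of pairs (vector, matrix). If two elements commute in
   F/C, then u^T v - v^T u is an integer multiple k of the skew matrix (a_ij).
   If k vanishes for all pairs from A, then all exponent vectors of elements of A
   are collinear and, since elements with zero exponent vector are central, A has
   rank at most one over the center. Hence some k is nonzero, and the Pluecker
   relation of the decomposable form u^T v - v^T u descends to a:
     a_12 a_34 + a_14 a_23 = a_13 a_24.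
   With X = a_12 a_34, Z = a_14 a_23 and Y = X + Z, multiplying the claim by
   |XYZ| turns it into Y (X + Z) > X Z, that is, X^2 + X Z + Z^2 > 0. *)
From HB Require Import structures.
Require Import Defs.
From mathcomp Require Import all_boot all_order all_algebra.
From mathcomp Require Import boolp classical_sets cardinality.
From mathcomp Require Import ring.

Set Implicit Arguments.
Unset Strict Implicit.
Unset Printing Implicit Defensive.

Import GRing.Theory Num.Theory.

Local Open Scope group_scope.

(** * Integer powers and generated subgroups *)

Section Powers.
Variable G : groupType.
Implicit Types (x y : G) (k l : int).

Lemma expgz_succ x k : expgz x (k + 1) = expgz x k * x.
Proof.
case: k => [n|[|n]] /=; first by rewrite addn1 expgSr.
- by rewrite expg1 mulVg.
- by rewrite subn1 [x ^+ n.+2]expgS invgM mulgVK.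
Qed.

Lemma expgzD x k l : expgz x (k + l) = expgz x k * expgz x l.
Proof.
elim/int_ind: l => [|n IH|n IH]; first by rewrite GRing.addr0 mulg1.
- by rewrite -[n.+1]addn1 PoszD GRing.addrA !expgz_succ IH mulgA.
- apply: (mulIg x); rewrite -mulgA -!expgz_succ -GRing.addrA.
  by rewrite -[n.+1]addn1 PoszD GRing.opprD GRing.subrK IH.
Qed.

(** The closure properties make [P] itself a subgroup containing [S], hence one of those intersected
    in [generated S]. *)
Lemma generated_ind (S : {pred G}) (P : G -> Prop) :
    P 1 -> (forall x, x \in S -> P x) ->
    (forall x y, P x -> P y -> P (x * y)) -> (forall x, P x -> P x^-1) ->
  forall x, x \in generated S -> P x.
Proof.
move=> P1 PS PM PV x /generatedP xS.
pose H : {pred G} := fun y => `[< P y >].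
have HM : mulg_closed H by move=> u v /asboolP Pu /asboolP Pv; apply/asboolP/PM.
have H1 : 1 \in H by apply/asboolP.
have HV : invg_closed H by move=> u /asboolP Pu; apply/asboolP/PV.
pose HH : groupClosed G := HB.pack H
  (isMulClosed.Build G H HM) (isMul1Closed.Build G H H1) (isInvClosed.Build G H HV).
by apply/asboolP/(xS HH) => y yS; apply/asboolP/PS.
Qed.

End Powers.

Lemma gmulfXz (G H : groupType) (f : UMagmaMorphism.type G H) k :
  {morph f : x / expgz x k}.
Proof. by case: k => n x; rewrite /expgz (gmulfXn, gmulfXVn). Qed.

(** * Word induction and the universal property of free groups *)

Section Generators.
Variable X : choiceType.

Lemma free_group_ind (P : free_group X -> Prop) :
    P 1 -> (forall i x, P x -> P (free_gen i * x)) ->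
    (forall i x, P x -> P ((free_gen i)^-1 * x)) ->
  forall x, P x.
Proof.
move=> P1 PM PV x; have [u ->] := fpi_surj x.
elim: u => [//|[i []] u IH].
- by rewrite -[fpi _]/(fpi ([:: (i, true)] ++ u)) -fpi_mul; apply: PM.
- rewrite -[fpi _]/(fpi ([:: (i, false)] ++ u)) -fpi_mul.
  by rewrite -[fpi [:: _]]/(fpi (word_inv [:: (i, true)])) -fpi_inv; apply: PV.
Qed.

Variables (H : groupType) (f : X -> H).

Definition word_eval (u : word X) : H :=
  \prod_(l <- u) (if l.2 then f l.1 else (f l.1)^-1).

Lemma word_eval_cat u v : word_eval (u ++ v) = word_eval u * word_eval v.
Proof. exact: big_cat. Qed.

Lemma word_eval_eq u v : free_eq u v -> word_eval u = word_eval v.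
Proof.
elim=> {u v} // [u v w _ -> _ -> //|u v x b].
rewrite !word_eval_cat /word_eval !big_cons big_nil mulg1.
by case: b; rewrite /= ?mulgV ?mulVg mul1g.
Qed.

Definition free_lift (x : free_group X) : H := word_eval (repr x).

Lemma free_lift_fpi u : free_lift (fpi u) = word_eval u.
Proof. exact/word_eval_eq/repr_fpi. Qed.

Lemma free_lift_gen i : free_lift (free_gen i) = f i.
Proof. by rewrite free_lift_fpi /word_eval big_seq1. Qed.

Lemma free_liftM : {morph free_lift : x y / x * y}.
Proof.
move=> x y; have [u ->] := fpi_surj x; have [v ->] := fpi_surj y.
by rewrite [fpi u * fpi v]fpi_mul !free_lift_fpi word_eval_cat.
Qed.

Lemma free_lift_div : {morph free_lift : x y / x / y}.
Proof.
by move=> x y; apply: (mulIg (free_lift y)); rewrite mulgVK -free_liftM mulgVK.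
Qed.

HB.instance Definition _ :=
  isGroupMorphism.Build (free_group X) H free_lift free_lift_div.

End Generators.

(** A homomorphism killing [N] descends to the quotient: its value on a class can be read off from
    any representative. *)
Lemma repr_qpi_morph (G H : groupType) (N : normalClosed G)
    (f : UMagmaMorphism.type G H) :
  (forall x, x \in N -> f x = 1) -> forall x, f (repr (qpi N x)) = f x.
Proof.
move=> fN x; apply: (mulgI (f (repr (qpi N x)))^-1).
by rewrite mulVg -gmulfV -gmulfM fN ?repr_qpi.
Qed.

(** * Commutator calculus in class 2 *)

Section Class2.
Variable G : groupType.
Hypothesis class2 : forall x y : G, [~ x, y] \in center G.
Implicit Types x y z : G.

(** In any group the first factor is [[~ x, z] ^ y]; centrality of commutators removes the
    conjugation. *)
Lemma class2_commMg x y z : [~ x * y, z] = [~ x, z] * [~ y, z].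
Proof.
have -> : [~ x * y, z] = [~ x, z] ^ y * [~ y, z].
  by rewrite !commgEl !conjgE invgM !mulgA !mulgK.
by have /centerP c := class2 x z; rewrite conjgE c mulKg.
Qed.

Lemma class2_commVg x z : [~ x^-1, z] = [~ x, z]^-1.
Proof.
by apply: (mulgI [~ x, z]); rewrite -class2_commMg !mulgV comm1g.
Qed.

End Class2.

Lemma prodgM_center (G : groupType) (I : Type) (r : seq I) (f g : I -> G) :
    (forall i, f i \in center G) ->
  \prod_(i <- r) (f i * g i) = \prod_(i <- r) f i * \prod_(i <- r) g i.
Proof.
move=> fC; elim: r => [|i r IH]; first by rewrite !big_nil mulg1.
have /centerP c : \prod_(j <- r) f j \in center G by apply: gpred_prod.
by rewrite !big_cons IH !mulgA -[f i * g i * _]mulgA -[g i * _]c mulgA.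
Qed.

Lemma prodg_expgz_delta (G : groupType) (n : nat) (c : 'I_n -> G) (i : 'I_n) k :
  \prod_(j < n) expgz (c j) (if j == i then k else 0%R) = expgz (c i) k.
Proof.
transitivity (\prod_(j < n | j == i) expgz (c j) k); last exact: big_pred1_eq.
by rewrite [RHS]big_mkcond /=; apply: eq_bigr => j _; case: eqP.
Qed.

(** * The Heisenberg-type group and exponent vectors *)

Section Heisenberg.
Local Open Scope ring_scope.
Variable n : nat.

(* The pair (u, M) stands for the class of the element with exponent vector u;
   M records the products of exponents that are collected on multiplying. *)
Definition heis := ('rV[int]_n * 'M[int]_n)%type.
HB.instance Definition _ := Choice.on heis.

Implicit Types (u v : 'rV[int]_n) (M N : 'M[int]_n) (X Y Z : heis).

Definition heis_one : heis := (0, 0).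
(** The central extension of Z^n by integer matrices given by the bilinear cocycle (u, v) -> u^T
    v. *)
Definition heis_mul X Y : heis :=
  (X.1 + Y.1, X.2 + Y.2 + X.1^T *m Y.1).
Definition heis_inv X : heis := (- X.1, - X.2 + X.1^T *m X.1).

Lemma heisP X Y :
  (forall i, X.1 0 i = Y.1 0 i) -> (forall i j, X.2 i j = Y.2 i j) -> X = Y.
Proof.
case: X Y => [u M] [v N] /= uv MN; congr pair; first exact/rowP.
exact/matrixP.
Qed.

Lemma outerE u v i j : (u^T *m v) i j = u 0 i * v 0 j.
Proof. by rewrite mxE big_ord1 mxE. Qed.

Lemma heis_mulA : associative heis_mul.
Proof.
by move=> X Y Z; apply: heisP => [i|i j]; rewrite /= ?(outerE, mxE); ring.
Qed.

Lemma heis_mul1g : left_id heis_one heis_mul.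
Proof.
by move=> X; apply: heisP => [i|i j]; rewrite /= ?(outerE, mxE); ring.
Qed.

Lemma heis_mulg1 : right_id heis_one heis_mul.
Proof.
by move=> X; apply: heisP => [i|i j]; rewrite /= ?(outerE, mxE); ring.
Qed.

Lemma heis_mulVg : left_inverse heis_one heis_inv heis_mul.
Proof.
by move=> X; apply: heisP => [i|i j]; rewrite /= ?(outerE, mxE); ring.
Qed.

Lemma heis_mulgV : right_inverse heis_one heis_inv heis_mul.
Proof.
by move=> X; apply: heisP => [i|i j]; rewrite /= ?(outerE, mxE); ring.
Qed.

HB.instance Definition _ := isGroup.Build heis
  heis_mulA heis_mul1g heis_mulg1 heis_mulVg heis_mulgV.

Lemma heis_mulE X Y : (X * Y)%g = (X.1 + Y.1, X.2 + Y.2 + X.1^T *m Y.1).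
Proof. by []. Qed.

Lemma heis_commE X Y : [~ X, Y]%g = (0, X.1^T *m Y.1 - Y.1^T *m X.1).
Proof.
(* Comparing through Y X [X, Y] = X Y avoids computing inverses. *)
apply: (mulgI (Y * X)%g); rewrite -commgC !heis_mulE.
by apply: heisP => [i|i j]; rewrite /= ?(outerE, mxE); ring.
Qed.

Lemma heis_expgz_fst X k : (expgz X k).1 = X.1 *~ k.
Proof.
have XE m : (X ^+ m)%g.1 = X.1 *+ m.
  by elim: m => // m IH; rewrite expgSr heis_mulE /= IH mulrSr.
by case: k => m; rewrite /= XE.
Qed.

Lemma heis_expgz_center M k : expgz ((0, M) : heis) k = (0, M *~ k).
Proof.
have ME m : (((0, M) : heis) ^+ m)%g = (0, M *+ m).
  elim: m => // m IH; rewrite expgSr IH heis_mulE /=.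
  by rewrite trmx0 mul0mx !addr0 mulrSr.
case: k => m; rewrite /= ME // -[LHS]/(heis_inv _) /heis_inv /=.
by rewrite oppr0 mulmx0 addr0.
Qed.

Definition heis_gen (i : 'I_n) : heis := (delta_mx 0 i, 0).

Definition heis_free : free_group 'I_n -> heis := free_lift heis_gen.
HB.instance Definition _ := UMagmaMorphism.on heis_free.

(** Vectors add, so commutators have vector 0; a pair with vector 0 commutes with everything, so
    triple commutators die. *)
Lemma heis_free_lower_central x :
  x \in lower_central (free_group 'I_n) 3 -> heis_free x = 1%g.
Proof.
move: x; apply: (@generated_ind _ _ (fun x => heis_free x = 1%g))
  => [|z /asboolP[x [y [x2 _ {z}->]]]|x y xE yE|x xE].
- exact: gmulf1.
- have x1 : (heis_free x).1 = 0.
    move: x x2; apply: (@generated_ind _ _ (fun x => (heis_free x).1 = 0))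
      => [|z /asboolP[u [v [_ _ ->]]]|u v uE vE|u uE].
    + by rewrite gmulf1.
    + by rewrite gmulfR heis_commE.
    + by rewrite gmulfM heis_mulE /= uE vE addr0.
    + by rewrite gmulfV -[LHS]/(- (heis_free u).1) uE oppr0.
  by rewrite gmulfR heis_commE x1 trmx0 mul0mx mulmx0 subr0.
- by rewrite gmulfM /= xE yE mulg1.
- by rewrite gmulfV /= xE invg1.
Qed.

Definition heis_of (x : free_nilpotent 2 n) : heis := heis_free (repr x).

Lemma heis_of_qpi x : heis_of (qpi _ x) = heis_free x.
Proof. exact: (repr_qpi_morph heis_free_lower_central). Qed.

Lemma heis_of_div : {morph heis_of : x y / (x / y)%g}.
Proof.
move=> x y; have [x' ->] := qpi_surj x; have [y' ->] := qpi_surj y.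
by rewrite -qpi_div !heis_of_qpi gmulfF.
Qed.

HB.instance Definition _ :=
  isGroupMorphism.Build (free_nilpotent 2 n) heis heis_of heis_of_div.

Lemma heis_of_gen i : heis_of (free_nilpotent_gen 2 i) = heis_gen i.
Proof. by rewrite heis_of_qpi [LHS]free_lift_gen. Qed.

Lemma free_nilpotent_ind c (P : free_nilpotent c n -> Prop) :
    P 1%g -> (forall i x, P x -> P (free_nilpotent_gen c i * x)%g) ->
    (forall i x, P x -> P ((free_nilpotent_gen c i)^-1 * x)%g) ->
  forall x, P x.
Proof.
move=> P1 PM PV x; have [y ->] := qpi_surj x.
elim/free_group_ind: y => [|i y IH|i y IH]; first by rewrite gmulf1.
  by rewrite gmulfM; apply: PM.
by rewrite gmulfM gmulfV; apply: PV.
Qed.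

(* As [~ x, y] is multiplicative in x, it only depends on the exponents of x. *)
Lemma free_nilpotent_commE (x y : free_nilpotent 2 n) :
  [~ x, y]%g =
  (\prod_(i < n) expgz [~ free_nilpotent_gen 2 i, y] ((heis_of x).1 0%R i))%g.
Proof.
have class2 := @free_nilpotent2_central n.
pose c i := [~ free_nilpotent_gen 2 i, y]%g.
(* Multiplying by the k-th power of [c i] shifts the i-th exponent by k; the induction uses k = 1
   and k = -1. *)
have step i k u :
    (expgz (c i) k * \prod_(j < n) expgz (c j) (u 0%R j) =
     \prod_(j < n) expgz (c j) ((k *: delta_mx 0 i + u)%R 0%R j))%g.
  rewrite -(prodg_expgz_delta c) -prodgM_center.
    apply: eq_bigr => j _; rewrite -expgzD; congr expgz.
    by rewrite !mxE; case: eqP => _; rewrite ?mulr1 ?mulr0.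
  by move=> j; apply/gpredXz/class2.
elim/free_nilpotent_ind: x => [|i x IH|i x IH].
- by rewrite comm1g gmulf1 big1 // => i _; rewrite mxE.
- rewrite (class2_commMg class2) IH gmulfM /= heis_of_gen.
  by have := step i 1 (heis_of x).1; rewrite scale1r.
- rewrite (class2_commMg class2) (class2_commVg class2) IH gmulfM gmulfV /=.
  by rewrite heis_of_gen; have := step i (-1) (heis_of x).1; rewrite scaleN1r.
Qed.

Lemma heis_of_fst0_center (x : free_nilpotent 2 n) :
  (heis_of x).1 = 0 -> x \in center (free_nilpotent 2 n).
Proof.
move=> x0; apply/centerP => y; apply/commgP/eqP.
by rewrite free_nilpotent_commE x0 big1 // => i _; rewrite mxE.
Qed.

End Heisenberg.

(** * Tensoring with the rationals, and dimension at most one *)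

Section TensorLine.
Variable H : groupType.
Local Open Scope ring_scope.
Implicit Types (x y : H) (p q : rat).

Lemma pure_tensorM x y q :
  pure_tensor (x * y)%g q = pure_tensor x q + pure_tensor y q.
Proof. by rewrite [RHS]tpi_add; apply/tpiP/tensor_addl. Qed.

Lemma pure_tensorZ x p q : p *: pure_tensor x q = pure_tensor x (p * q).
Proof. exact: tpi_scale. Qed.

Lemma pure_tensor1 q : pure_tensor (1%g : H) q = 0.
Proof.
by apply: (addIr (pure_tensor 1%g q)); rewrite -pure_tensorM mulg1 add0r.
Qed.

Lemma pure_tensorV x q : pure_tensor x^-1%g q = - pure_tensor x q.
Proof.
apply: (addIr (pure_tensor x q)).
by rewrite -pure_tensorM mulVg addNr pure_tensor1.
Qed.

Lemma pure_tensorXz x k q :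
  pure_tensor (expgz x k) q = k%:~R *: pure_tensor x q.
Proof.
have XE m : pure_tensor (x ^+ m)%g q = pure_tensor x q *+ m.
  by elim: m => [|m IH]; rewrite ?pure_tensor1 // expgSr pure_tensorM IH mulrSr.
by case: k => m; rewrite scaler_int /= ?pure_tensorV XE.
Qed.

(** Denominators can be cleared: if x^m = x0^n with m nonzero, then x ⊗ q = x^m ⊗ (q/m) = x0^n ⊗
    (q/m) = (n q/m)(x0 ⊗ 1). *)
Lemma tensor_rat_line (x0 : H) :
    (forall x, exists m n : int, m != 0 /\ expgz x m = expgz x0 n) ->
  forall v : tensor_rat H, exists c, v = c *: pure_tensor x0 1.
Proof.
move=> line v; have [s ->] := tpi_surj v.
elim: s => [|[x q] s [c IH]]; first by exists 0; rewrite scale0r.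
have [m [n [m0 xm]]] := line x.
exists (n%:~R * (q / m%:~R) + c).
rewrite scalerDl -IH -scalerA pure_tensorZ mulr1 -pure_tensorXz -xm.
by rewrite pure_tensorXz pure_tensorZ mulrC divfK ?intr_eq0 // [RHS]tpi_add.
Qed.

End TensorLine.

Local Open Scope ring_scope.

Lemma line_not_dim_gt1 (K : fieldType) (V : lmodType K) (t : V) :
  (forall v, exists c : K, v = c *: t) -> ~ dim_gt V 1.
Proof.
move=> line [B [Bfree _]]; apply.
have B0 v : B v -> v != 0.
  move=> Bv; apply/eqP => v0.
  have Bs w : w \in [:: v] -> B w by rewrite inE => /eqP ->.
  have := Bfree [:: v] (fun=> 1) isT Bs; rewrite big_seq1 v0 scaler0.
  by move=> /(_ erefl 0); rewrite inE eqxx => /(_ isT)/eqP; rewrite oner_eq0.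
have B1 v w : B v -> B w -> v = w.
  move=> Bv Bw; apply/eqP/negPn/negP => vw.
  have [c vE] := line v; have [d wE] := line w.
  have vws : uniq [:: v; w] by rewrite /= inE vw.
  have Bs : forall z, z \in [:: v; w] -> B z.
    by move=> z; rewrite !inE => /orP[] /eqP ->.
  (* With v = c t and w = d t, the relation d v - c w = 0 forces d = 0, hence w = 0, which [B0]
     excludes. *)
  have := Bfree _ (fun z => if z == v then d else - c) vws Bs.
  rewrite big_cons big_seq1 eqxx eq_sym (negPf vw) => /(_ _ v).
  rewrite inE eqxx => d0; have /eqP := B0 _ Bw; apply.
  rewrite wE d0 ?scale0r // {1}vE {1}wE !scalerA -scalerDl mulrC mulNr subrr.
  exact: scale0r.
have [->|/set0P[v Bv]] := eqVneq B set0; first exact: card_ge0.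
have -> : B = [set v]%classic.
  by rewrite eqEsubset; split=> [w Bw|w ->//]; apply: B1.
by rewrite (card_le_eql card_set1).
Qed.

(** * Commutation and rank in the cyclic quotient *)

Section CyclicQuotient.
Variables (n : nat) (a : 'I_n -> 'I_n -> int).

Definition relator_mx : 'M[int]_n :=
  \sum_(i < n) \sum_(j < n | (i < j)%N) a i j *: (delta_mx i j - delta_mx j i).

Lemma relator_mxE (k l : 'I_n) : (k < l)%N -> relator_mx k l = a k l.
Proof.
move=> kl; have klF : (k == l) = false by rewrite -val_eqE ltn_eqF.
rewrite summxE (bigD1 k) //= [X in _ + X]big1 ?addr0 => [|i ik].
  rewrite summxE (bigD1 l) //= big1 ?addr0 => [|j /andP[_ jl]].
    by rewrite !mxE !eqxx klF subr0 mulr1.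
  by rewrite !mxE eqxx eq_sym (negPf jl) (eq_sym l) klF !andbF subrr mulr0.
rewrite summxE big1 // => j ij; rewrite !mxE eq_sym (negPf ik) /=.
case: eqP => [kj|_]; last by rewrite subrr mulr0.
case: eqP => [li|_]; last by rewrite subrr mulr0.
by move: ij; rewrite -kj -li ltnNge (ltnW kl).
Qed.

Lemma heis_of_relator : heis_of (relator a) = (0, relator_mx) :> heis n.
Proof.
have inM : {morph (fun M : 'M[int]_n => (0, M) : heis n) :
    M N / M + N >-> (M * N)%g}.
  by move=> M N; rewrite heis_mulE /= trmx0 mul0mx !addr0.
rewrite gmulf_prod /= [RHS](big_morph _ inM (erefl _)); apply: eq_bigr => i _.
rewrite gmulf_prod /= [RHS](big_morph _ inM (erefl _)); apply: eq_bigr => j _.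
rewrite gmulfXz gmulfR /= !heis_of_gen heis_commE heis_expgz_center /=.
by rewrite -scaler_int intz !trmx_delta !mul_delta_mx.
Qed.

Lemma heis_of_cyclic_relator x :
  x \in cyclic_relator a -> exists k : int, heis_of x = (0, k *: relator_mx).
Proof.
move: x; apply: generated_ind => [|x /eqP ->|x y [k xE] [l yE]|x [k xE]].
- by exists 0; rewrite gmulf1 scale0r.
- by exists 1; rewrite heis_of_relator scale1r.
- exists (k + l); rewrite gmulfM /= xE yE heis_mulE /=.
  by rewrite trmx0 mul0mx !addr0 scalerDl.
- exists (- k); rewrite gmulfV /= xE -[LHS]/(heis_inv _) /heis_inv /=.
  by rewrite oppr0 mulmx0 addr0 scaleNr.
Qed.

Local Notation G := (free_nilpotent2_mod a).
Local Notation qG := (qpi (cyclic_relator a)).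

(** Images commute exactly when [x, y] lies in C, whose elements map to multiples of
    [(0, relator_mx)]. *)
Lemma commute_relator_mx (x y : free_nilpotent 2 n) :
    commute (qG x) (qG y) -> exists k : int,
  (heis_of x).1^T *m (heis_of y).1 - (heis_of y).1^T *m (heis_of x).1 =
  k *: relator_mx.
Proof.
move=> /commgP/eqP xy; have /esym/qpiP : qG [~ x, y]%g = qG 1%g.
  by rewrite gmulfR xy.
rewrite invg1 mul1g => /heis_of_cyclic_relator[k].
by rewrite gmulfR heis_commE => /(congr1 snd) xyE; exists k.
Qed.

Lemma collinear_rank (A : groupClosed G) :
    (forall x y, qG x \in A -> qG y \in A ->
      (heis_of x).1^T *m (heis_of y).1 = (heis_of y).1^T *m (heis_of x).1) ->
  ~ rank_over_center_gt A 1.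
Proof.
move=> col.
(* Here x^-k y^l has exponent vector 0, so it is central, and its image in the quotient is central
   too. *)
have powE (x y : free_nilpotent 2 n) (s t : subgroup_type A) (k l : int) :
    val s = qG x -> val t = qG y ->
    (heis_of x).1 *~ k = (heis_of y).1 *~ l ->
  expgz (qpi (@trace_normal G A (center G)) s) k =
  expgz (qpi (@trace_normal G A (center G)) t) l.
  move=> sx ty kl; rewrite -!gmulfXz; apply/qpiP; rewrite trace_normalE.
  rewrite gmulfM gmulfV !gmulfXz /= sx ty -!gmulfXz -gmulfV -gmulfM.
  have /centerP c :
      ((expgz x k)^-1 * expgz y l)%g \in center (free_nilpotent 2 n).
    apply: heis_of_fst0_center; rewrite gmulfM gmulfV !gmulfXz /=.
    by rewrite !heis_expgz_fst kl addNr.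
  apply/centerP => z; have [z' ->] := qpi_surj z.
  exact/gmulf_commute/c.
suff [t] : exists t : subquotient A (center G), forall x, exists m n : int,
    m != 0 /\ expgz x m = expgz t n.
  by move=> /tensor_rat_line/line_not_dim_gt1.
have [[x [Ax x0]]|all0] := pselect (exists x, qG x \in A /\ (heis_of x).1 != 0).
  have [i xi0] : exists i, (heis_of x).1 0 i != 0.
    by apply/existsP; apply: contraR x0 => /existsPn x0; apply/eqP/rowP => i;
      rewrite mxE; apply/eqP/negPn.
  exists (qpi _ (Sub (qG x) Ax : subgroup_type A)) => z.
  have [s ->] := qpi_surj z; have [y sy] := qpi_surj (val s).
  (* Row i of the equality of outer products of u (for x) and v (for y) reads u_i v = v_i u, with
     u_i nonzero. *)
  exists ((heis_of x).1 0 i), ((heis_of y).1 0 i); split=> //.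
  apply: (powE y x) => //; rewrite -!scaler_int !intz; apply/rowP => j.
  have := col x y Ax; rewrite -sy (valP s) => /(_ isT)/matrixP/(_ i j).
  by rewrite !outerE !mxE.
(* All exponent vectors vanish, so A is trivial modulo the center and the base point 1 serves. *)
exists 1%g => z; have [s ->] := qpi_surj z; have [y sy] := qpi_surj (val s).
exists 1, 0; split=> //.
apply: (powE y 1%g s 1%g 1 0) => //; rewrite mulr0z mulr1z.
have [//|y0] := eqVneq (heis_of y).1 0.
by case: all0; exists y; rewrite -sy (valP s).
Qed.

End CyclicQuotient.

(** * Rank 4: the Plücker relation and the inequality *)

Lemma prod_lt4 (R : comNzRingType) (f : 'I_4 -> 'I_4 -> R) :
  \prod_(i < 4) \prod_(j < 4 | (i < j)%N) f i j =
  f 0 1 * f 0 2 * f 0 3 * f 1 2 * f 1 3 * f 2 3.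
Proof.
(* Indexing by naturals lets the ordinals from unfolding the products agree with the literals by
   computation. *)
pose g (i j : nat) := f (inord i) (inord j).
have fE (i j : 'I_4) : f i j = g i j by rewrite /g !inord_val.
rewrite !fE; under eq_bigr do (rewrite big_mkcond; under eq_bigr do rewrite fE).
rewrite !(big_ord_recr, big_ord0) /=.
by rewrite !mul1r !mulr1 !mulrA.
Qed.

(** The entries of [p] are the 2x2 minors of the matrix with rows u and v. *)
Lemma plucker_decomposable (R : comNzRingType) (u v : 'rV[R]_4) :
  let p := u^T *m v - v^T *m u in
  p 0 1 * p 2 3 + p 0 3 * p 1 2 = p 0 2 * p 1 3.
Proof. by rewrite /= !mxE !big_ord1 !mxE; ring. Qed.

Lemma sgn_inv_gt (R : realFieldType) (x y z : R) :
    x != 0 -> y != 0 -> z != 0 -> x + z = y ->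
  `|x * y * z| / (x * y * z) * (1 / y) <
  `|x * y * z| / (x * y * z) * (1 / z + 1 / x).
Proof.
move=> x0 y0 z0 xzy; set w := x * y * z.
have w0 : w != 0 by rewrite !mulf_neq0.
rewrite -subr_gt0.
(* With y = x + z, 1/z + 1/x - 1/y = (x^2 + xz + z^2)/w, and the numerator is half a sum of three
   squares. *)
have -> : `|w| / w * (1 / z + 1 / x) - `|w| / w * (1 / y) =
          `|w| / w ^+ 2 * (((x + z) ^+ 2 + x ^+ 2 + z ^+ 2) / 2).
  by rewrite /w -xzy; field; rewrite xzy x0 y0 z0.
have pos : 0 < (x + z) ^+ 2 + x ^+ 2 + z ^+ 2.
  by rewrite ltr_wpDr ?sqr_ge0 // ltr_wpDl ?sqr_ge0 // exprn_even_gt0.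
by rewrite mulr_gt0 ?divr_gt0 ?normr_gt0 // exprn_even_gt0.
Qed.

Theorem theoremB (a : 'I_4 -> 'I_4 -> int)
    (a_neq0 : forall i j : 'I_4, (i < j)%N -> a i j != 0) :
  let P : int := \prod_(i < 4) \prod_(j < 4 | (i < j)%N) a i j in
  let eps : rat := `|P|%:~R / P%:~R in
  let b (i j : 'I_4) : rat := (a i j)%:~R in
  (exists A : groupClosed (free_nilpotent2_mod a),
     [/\ {in A &, forall x y, commute x y},
         {subset center (free_nilpotent2_mod a) <= A}
       & rank_over_center_gt A 1]) ->
  eps * (1 / (b 0 3 * b 1 2) + 1 / (b 0 1 * b 2 3)) > eps * (1 / (b 0 2 * b 1 3)).
Proof.
move=> P eps b [A [Acomm _ rankA]].
have pluckerA : a 0 1 * a 2 3 + a 0 3 * a 1 2 = a 0 2 * a 1 3.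
  (* If the relation failed, every multiplier k would be 0, making all exponent vectors from A
     collinear. *)
  apply: contrapT => noplucker; apply: collinear_rank rankA => x y Ax Ay.
  have [k xyE] := commute_relator_mx (Acomm _ _ Ax Ay).
  apply/eqP; rewrite -subr_eq0 xyE.
  have [->|k0] := eqVneq k 0; first by rewrite scale0r.
  have kS (i j : 'I_4) : (i < j)%N -> (k *: relator_mx a) i j = k * a i j.
    by move=> ij; rewrite mxE relator_mxE.
  have := plucker_decomposable (heis_of x).1 (heis_of y).1.
  rewrite /= xyE !kS // => kE.
  (* The relation is quadratic, so k cancels twice. *)
  case: noplucker; apply: (mulfI k0); apply: (mulfI k0).
  transitivity (k * a 0 1 * (k * a 2 3) + k * a 0 3 * (k * a 1 2)).
    by ring.
  by rewrite kE; ring.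
have b0 (i j : 'I_4) : (i < j)%N -> b i j != 0.
  by move=> ij; rewrite intr_eq0 a_neq0.
(* The three complementary pairs play the roles of x, y, z in [sgn_inv_gt]. *)
have PE : P%:~R = (b 0 1 * b 2 3) * (b 0 2 * b 1 3) * (b 0 3 * b 1 2).
  by rewrite /P prod_lt4 /b !rmorphM /=; ring.
rewrite /eps intr_norm PE; apply: sgn_inv_gt; rewrite ?mulf_neq0 ?b0 //.
by rewrite /b -!rmorphM -rmorphD pluckerA.
Qed.
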